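(* Let $a=(a_k)_{k\ge1}$ be a sequence of complex numbers with $a_1=0$, let $\lambda$ be a strict partition with $\ell(\lambda)=l$, and let $n\ge l$. Let $A_0(x_1,\dots,x_n)$ be the skew-symmetric $n\times n$ matrix $\left(\frac{x_i-x_j}{x_i+x_j}\right)_{1\le i,j\le n}$ and $B_\lambda(x_1,\dots,x_n)$ the $n\times l$ matrix $\left((x_i\mid a)^{\lambda_{l+1-j}}\right)_{1\le i\le n,\,1\le j\le l}$. Let $A_\lambda(x_1,\dots,x_n)$ be the skew-symmetric $(n+l)\times(n+l)$ matrix $$\begin{pmatrix}A_0(x_1,\dots,x_n)&B_\lambda(x_1,\dots,x_n)\\-B_\lambda(x_1,\dots,x_n)^t&0\end{pmatrix}.$$ Put $\operatorname{Pf}_0(x_1,\dots,x_n)=\operatorname{Pf}(A_0(x_1,\dots,x_n))$ if $n$ is even and $\operatorname{Pf}(A_0(x_1,\dots,x_n,0))$ if $n$ is odd; put $\operatorname{Pf}_\lambda(x_1,\dots,x_n)=\operatorname{Pf}(A_\lambda(x_1,\dots,x_n))$ if $n+l$ is even and $\operatorname{Pf}(A_\lambda(x_1,\dots,x_n,0))$ if $n+l$ is odd. Then $$P_{\lambda;a}(x_1,\dots,x_n)=\frac{\operatorname{Pf}_\lambda(x_1,\dots,x_n)}{\operatorname{Pf}_0(x_1,\dots,x_n)}.$$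
   Context: A strict partition is $\lambda=(\lambda_1>\dots>\lambda_l>0)$, $\ell(\lambda)=l$. Put $(x\mid a)^k=\prod_{m=1}^k(x-a_m)$, $(x\mid a)^0=1$. For $\ell(\lambda)=l\le n$, $$P_{\lambda;a}(x_1,\dots,x_n)=\frac1{(n-l)!}\sum_{\omega\in S(n)}\prod_{i=1}^l (x_{\omega(i)}\mid a)^{\lambda_i}\prod_{1\le i\le l,\ i<j\le n}\frac{x_{\omega(i)}+x_{\omega(j)}}{x_{\omega(i)}-x_{\omega(j)}}$$ (a polynomial, the multiparameter Schur P-function). The Pfaffian of a skew-symmetric $2m\times2m$ matrix $A=(a_{ij})$ is $\operatorname{Pf}(A)=\sum_{\omega}\operatorname{sgn}(\omega)\prod_{i=1}^m a_{\omega(2i-1)\omega(2i)}$, summed over $\omega\in S(2m)$ with $\omega(2i-1)<\omega(2i)$ for all $i$ and $\omega(1)<\omega(3)<\dots<\omega(2m-1)$. Diagonal entries of $A_0$ are $0$; when a variable $0$ is appended, the corresponding entries are computed by the same formulas with that variable equal to $0$ (so $\frac{x_i-0}{x_i+0}=1$). The identity is one of rational functions in $x_1,\dots,x_n$. *)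

(* Defs.v *)
From HB Require Import structures.
From mathcomp Require Import all_boot all_order all_fingroup all_algebra.
From mathcomp Require Import fraction complex reals.
From mathcomp Require Import mpoly.

Set Implicit Arguments.
Unset Strict Implicit.
Unset Printing Implicit Defensive.

Import GRing.Theory.
Local Open Scope ring_scope.

Definition strict_partition (lam : seq nat) : bool :=
  sorted gtn lam && all (fun k => 0 < k)%N lam.

Section Pfaffian.
Variable R : comNzRingType.

Lemma pfidx_odd_subproof N (i : 'I_N./2) : (i.*2.+1 < N)%N.
Proof.
by rewrite -[N in (_ < N)%N]odd_double_half (leq_trans _ (leq_addl _ _)) //
  -doubleS leq_double.
Qed.

Lemma pfidx_even_subproof N (i : 'I_N./2) : (i.*2 < N)%N.
Proof. exact: ltnW (pfidx_odd_subproof i). Qed.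

(* The indices 2i-1 and 2i of {1, .., N}, for i in {1, .., N/2}, counting
   from 0. *)
Definition pfidx1 N (i : 'I_N./2) : 'I_N := Ordinal (pfidx_even_subproof i).
Definition pfidx2 N (i : 'I_N./2) : 'I_N := Ordinal (pfidx_odd_subproof i).

Definition pf_perm N (s : 'S_N) : bool :=
  [forall i : 'I_N./2, s (pfidx1 i) < s (pfidx2 i)]%N &&
  [forall i : 'I_N./2, forall j : 'I_N./2,
     (i < j) ==> (s (pfidx1 i) < s (pfidx1 j))]%N.

(* Meaningful for even N only; taking any N as the size avoids casts between
   matrix types. *)
Definition Pf N (A : 'M[R]_N) : R :=
  \sum_(s : 'S_N | pf_perm s)
    (-1) ^+ odd_perm s * \prod_(i < N./2) A (s (pfidx1 i)) (s (pfidx2 i)).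

End Pfaffian.

Section SchurP.
Variable F : fieldType.

(* (x | a)^k; the sequence a starts at a 1, and a 0 is never used. *)
Definition mpow (a : nat -> F) (x : F) (k : nat) : F :=
  \prod_(1 <= m < k.+1) (x - a m).

Definition schurP (a : nat -> F) l (lam : l.-tuple nat) n (x : 'rV[F]_n) : F :=
  ((n - l)`!%:R)^-1 *
  \sum_(w : 'S_n)
    (\prod_(i < n | (i < l)%N) mpow a (x 0 (w i)) (nth 0%N lam i)) *
    (\prod_(i < n | (i < l)%N) \prod_(j < n | (i < j)%N)
       ((x 0 (w i) + x 0 (w j)) / (x 0 (w i) - x 0 (w j)))).

(* The test on the diagonal matters for a variable equal to 0. *)
Definition A0 n (x : 'rV[F]_n) : 'M[F]_n :=
  \matrix_(i, j) if i == j then 0 else (x 0 i - x 0 j) / (x 0 i + x 0 j).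

(* With j counted from 0, lambda_{l+1-j} is the entry of index
   l - 1 - j = rev_ord j. *)
Definition Blam (a : nat -> F) l (lam : l.-tuple nat) n (x : 'rV[F]_n) :
    'M[F]_(n, l) :=
  \matrix_(i, j) mpow a (x 0 i) (tnth lam (rev_ord j)).

Definition Alam (a : nat -> F) l (lam : l.-tuple nat) n (x : 'rV[F]_n) :
    'M[F]_(n + l) :=
  block_mx (A0 x) (Blam a lam x) (- (Blam a lam x)^T) 0.

Definition append0 n (x : 'rV[F]_n) : 'rV[F]_(n + 1) := row_mx x 0.

Definition Pf0 n (x : 'rV[F]_n) : F :=
  if odd n then Pf (A0 (append0 x)) else Pf (A0 x).

Definition Pflam (a : nat -> F) l (lam : l.-tuple nat) n (x : 'rV[F]_n) : F :=
  if odd (n + l) then Pf (Alam a lam (append0 x)) else Pf (Alam a lam x).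

End SchurP.

Notation ratfun C n := {fraction {mpoly C[n]}}.

Section RationalFunctions.
Variables (C : fieldType) (n : nat).

Definition ratC (c : C) : ratfun C n := FracField.tofrac (c%:MP_[n]).

Definition ratX : 'rV[ratfun C n]_n := \row_(i < n) FracField.tofrac 'X_i.

End RationalFunctions.

(* Main.v *)
(* Both sides obey the same recursion on the length of lambda. Write V(x) for
   the product of the (x_i - x_j) / (x_i + x_j) over i < j. Expanding the
   Pfaffian of A_lambda along its last column, the one of lambda_1, gives the
   sum over i of (-1)^(i-1) (x_i | a)^lambda_1 times the Pfaffian for
   (lambda_2, .., lambda_l) and the variables other than x_i. Since
   V(x) prod_{j <> i} (x_i + x_j) / (x_i - x_j) = (-1)^(i-1) V(x without x_i),
   this is V(x) times the recursion for P_lambda obtained by summing first over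
   omega(1) = i. A row of A_lambda for an appended variable 0 does not
   contribute, as (0 | a)^k = 0 for k > 0 when a_1 = 0.

   The base case is Schur's evaluation of Pf_0 as V. Its expansion along the
   first row reduces it to a partial fraction identity, which is the
   leading-coefficient form of Lagrange interpolation for the polynomial
   (t - X) prod_y (X + y) at the nodes -t, 0 and the y. *)

Require Import Defs.
From HB Require Import structures.
From mathcomp Require Import all_boot all_order all_fingroup all_algebra.
From mathcomp Require Import fraction complex reals.
From mathcomp Require Import mpoly.
From mathcomp Require Import ring zify.

Set Implicit Arguments.
Unset Strict Implicit.
Unset Printing Implicit Defensive.

Import GRing.Theory.
Local Open Scope ring_scope.

(** * Sequences with one element removed *)

Section RemUniq.
Variable T : eqType.
Implicit Type s : seq T.

(** [bump i] underlies [lift i], so removing an entry of a sequence mirrors deleting an index of a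
    matrix. *)
Lemma nth_rem (x0 : T) s i k :
  uniq s -> (i < size s)%N -> nth x0 (rem (nth x0 s i) s) k = nth x0 s (bump i k).
Proof.
move=> us lt_is; rewrite remE index_uniq // nth_cat size_take lt_is /bump.
have [lt_ki|le_ik] := ltnP k i; first by rewrite nth_take // add0n.
by rewrite nth_drop; congr nth; lia.
Qed.

Lemma remC s x y : uniq s -> rem x (rem y s) = rem y (rem x s).
Proof.
move=> us; rewrite !(rem_filter _ (rem_uniq _ us)) !rem_filter // -!filter_predI.
by apply: eq_filter => z /=; rewrite andbC.
Qed.

Lemma rem_cat_in s1 s2 x : x \in s1 -> rem x (s1 ++ s2) = rem x s1 ++ s2.
Proof.
by elim: s1 => //= y s1 IH; rewrite inE eq_sym; case: eqVneq => //= _ /IH->.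
Qed.

Lemma rem_rcons_in s c x : x \in s -> rem x (rcons s c) = rcons (rem x s) c.
Proof. by rewrite -!cats1; apply: rem_cat_in. Qed.

Lemma rem_rcons_last s c : c \notin s -> rem c (rcons s c) = s.
Proof.
elim: s => [|y s IH] /=; first by rewrite eqxx.
by rewrite inE negb_or eq_sym => /andP[/negPf-> /IH->].
Qed.

Lemma index_rcons_in s c x : x \in s -> index x (rcons s c) = index x s.
Proof. by move=> xs; rewrite -cats1 index_cat xs. Qed.

Lemma index_rem s x y : uniq s -> x \in s -> x != y ->
  index x (rem y s) = (index x s - (index y s < index x s))%N.
Proof.
elim: s => //= z s IH /andP[zs us]; rewrite inE.
case: (eqVneq z y) => [<-|nzy]; case: (eqVneq z x) => [<-|nzx] //=; rewrite ?eqxx //.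
  by move=> xs _; rewrite subn1.
by move=> xs nxy; rewrite (negPf nzx) IH // ltnS; have := index_mem y s; lia.
Qed.

Lemma big_rem_swap (R : nmodType) s (G : T -> T -> R) : uniq s ->
  \sum_(i <- s) \sum_(j <- rem i s) G i j = \sum_(j <- s) \sum_(i <- rem j s) G i j.
Proof.
move=> us.
transitivity (\sum_(i <- s) \sum_(j <- s | j != i) G i j).
  by apply: eq_bigr => i _; rewrite rem_filter // big_filter.
rewrite (exchange_big_dep predT) //=; apply: eq_bigr => j _.
by rewrite rem_filter // big_filter; apply: eq_bigl => i; rewrite /= eq_sym.
Qed.

End RemUniq.

Lemma rem_map (T1 T2 : eqType) (g : T1 -> T2) s x :
  injective g -> rem (g x) (map g s) = map g (rem x s).
Proof. by move=> ig; elim: s => //= y s IH; rewrite (inj_eq ig) IH; case: ifP. Qed.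

(** Removing one entry lowers the index of the other exactly when the removed one comes first, so
    the two exponents differ by one. *)
Lemma sign_index_rem (R : pzRingType) (T : eqType) (s : seq T) i j :
  uniq s -> i \in s -> j \in s -> i != j ->
  (-1) ^+ (index j s + index i (rem j s)) =
  - (-1) ^+ (index i s + index j (rem i s)) :> R.
Proof.
move=> us is_ js nij; rewrite -[RHS]mulN1r -exprS !index_rem // 1?eq_sym //.
have : index i s != index j s.
  by apply: contraNneq nij => e; rewrite -(nth_index i is_) e nth_index.
rewrite -(signr_odd _ (_ + _)) -[RHS]signr_odd => h; congr (_ ^+ nat_of_bool _); lia.
Qed.

(** * Pfaffians of sequences *)

Section SeqPfaffian.
Variables (R : comNzRingType) (T : eqType) (f : T -> T -> R).

(* The Pfaffian of (f s_i s_j) for a sequence s of 2 m distinct elements,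
   expanded along the first row. *)
Fixpoint pfs m (s : seq T) : R :=
  match m, s with
  | m'.+1, x :: s' =>
      \sum_(y <- s') (-1) ^+ index y s' * f x y * pfs m' (rem y s')
  | m'.+1, [::] => 0
  | 0, _ => 1
  end.

Lemma pfs_cons m x s : pfs m.+1 (x :: s) =
  \sum_(y <- s) (-1) ^+ index y s * f x y * pfs m (rem y s).
Proof. by []. Qed.

(** By induction: expand along the first row, then each minor along its last column, and exchange
    the double sum. The sign change of [sign_index_rem] is made up for by the head [x], which shifts
    the indices on the right by one. *)
Lemma pfs_rcons m s c : uniq (rcons s c) -> size s = m.*2.+1 ->
  pfs m.+1 (rcons s c) =
  \sum_(y <- s) (-1) ^+ index y s * f y c * pfs m (rem y s).
Proof.
elim: m s => [|m IH] [|x s] // uxsc [szs].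
  by case: s szs uxsc => //= _ _; rewrite !big_seq1 /= !eqxx.
move: uxsc; rewrite rcons_cons [uniq _]/= rcons_uniq mem_rcons inE negb_or.
case/andP=> /andP[nxc xs] /andP[cs us].
(* The pair of [x] and [c] is split off on both sides; [c] has an even index in [rcons s c], so the
   signs agree. *)
rewrite pfs_cons big_rcons big_cons.
have -> : rem x (x :: s) = s by rewrite /= eqxx.
have -> : index x (x :: s) = 0%N by rewrite /= eqxx.
rewrite expr0 mul1r.
have -> : index c (rcons s c) = m.+1.*2.
  by rewrite -cats1 index_cat (negPf cs) /= eqxx addn0.
rewrite rem_rcons_last //.
rewrite -signr_odd odd_double expr0 mul1r addrC; congr (_ + _).
have IHj j : j \in s -> pfs m.+1 (rem j (rcons s c)) =
    \sum_(i <- rem j s) (-1) ^+ index i (rem j s) * f i c * pfs m (rem i (rem j s)).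
  move=> js; rewrite rem_rcons_in // IH //; last by rewrite size_rem // szs.
  by rewrite rcons_uniq rem_uniq // andbT; apply: contra cs; apply: mem_rem.
pose G j i := (-1) ^+ (index j s + index i (rem j s)) * f x j * f i c *
  pfs m (rem i (rem j s)).
transitivity (\sum_(j <- s) \sum_(i <- rem j s) G j i).
  rewrite !big_seq; apply: eq_bigr => j js.
  rewrite index_rcons_in // IHj // big_distrr; apply: eq_bigr => i _ /=.
  by rewrite /G exprD; ring.
rewrite big_rem_swap // !big_seq; apply: eq_bigr => i i_s.
have nxi : (x == i) = false by apply: contraNF xs => /eqP->.
have -> : rem i (x :: s) = x :: rem i s by rewrite /= nxi.
have -> : index i (x :: s) = (index i s).+1 by rewrite /= nxi.
rewrite pfs_cons big_distrr !big_seq; apply: eq_bigr => j.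
rewrite mem_rem_uniq // inE => /andP[nji js].
by rewrite /G sign_index_rem // 1?eq_sym // (remC i j) // exprS exprD /=; ring.
Qed.

End SeqPfaffian.

(** * Expansion of [Pf] along the first row *)

Lemma big_perm_lift (R : nmodType) n (i j : 'I_n.+1) (Q : pred 'S_n.+1)
    (G : 'S_n.+1 -> R) :
  \sum_(s : 'S_n.+1 | (s i == j) && Q s) G s =
  \sum_(t : 'S_n | Q (lift_perm i j t)) G (lift_perm i j t).
Proof.
rewrite (reindex (lift_perm i j)) /=.
  by apply: eq_bigl => t; rewrite lift_perm_id eqxx.
(* [h k s] is [s] with [k] deleted from the domain and [s k] from the range; the default [m] never
   occurs, as [s (lift k m)] differs from [s k]. *)
pose h k (s : 'S_n.+1) m := odflt m (unlift (s k) (s (lift k m))).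
have hK k (s : 'S_n.+1) m : lift (s k) (h k s m) = s (lift k m).
  rewrite /h; have:= neq_lift k m.
  by rewrite -(can_eq (permK s)) => /unlift_some[] ? ? ->.
have h_inj s : injective (h i s).
  apply: can_inj (h (s i) s^-1%g) _ => m.
  by rewrite {1}/h hK !permK liftK.
exists (fun s => perm (h_inj s)) => [s _ | s /andP[/eqP si _]].
  by apply/permP=> m; rewrite permE /h lift_perm_lift lift_perm_id liftK.
apply/permP=> k; case: (unliftP i k) => [m|] ->; rewrite ?lift_perm_id //.
by rewrite lift_perm_lift -si permE hK.
Qed.

(** As [N] is even, every position lies in a pair. If 0 closed a pair, its opening entry would be
    smaller; if 0 opened a later pair, the entry opening the first pair would be smaller. *)
Lemma pf_perm0 N (s : 'S_N.+2) : ~~ odd N -> pf_perm s -> s 0 == 0.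
Proof.
move=> evN /andP[/forallP s12 /forallP s11].
rewrite -(inj_eq (@perm_inj _ s^-1%g)) permK; set k := (s^-1 0)%g.
have sk : s k = 0 by rewrite permKV.
have hk : (k./2 < N.+2./2)%N by have := ltn_ord k; lia.
have [k_odd|k_even] := boolP (odd k).
  have := s12 (Ordinal hk); suff -> : pfidx2 (Ordinal hk) = k by rewrite sk.
  by apply: val_inj => /=; lia.
have [k0|k_gt0] := posnP k; first by rewrite eq_sym; apply/eqP/val_inj.
have /forallP/(_ (Ordinal hk)) /implyP := s11 ord0.
have -> : pfidx1 (Ordinal hk) = k by apply: val_inj => /=; lia.
by rewrite sk /= => /(_ _)-/implyP; have -> : (0 < k./2)%N by lia.
Qed.

Lemma pfidx1_lift N (i : 'I_N./2) :
  pfidx1 (lift ord0 i : 'I_(N.+2)./2) = lift ord0 (lift ord0 (pfidx1 i)).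
Proof. by apply: val_inj; rewrite /= /bump /=; lia. Qed.

Lemma pfidx2_lift N (i : 'I_N./2) :
  pfidx2 (lift ord0 i : 'I_(N.+2)./2) = lift ord0 (lift ord0 (pfidx2 i)).
Proof. by apply: val_inj; rewrite /= /bump /=; lia. Qed.

Lemma pfidx1_0 N : pfidx1 (ord0 : 'I_(N.+2)./2) = ord0.
Proof. exact: val_inj. Qed.

Lemma pfidx2_0 N : pfidx2 (ord0 : 'I_(N.+2)./2) = lift ord0 ord0.
Proof. exact: val_inj. Qed.

Lemma ltn_lift N (h : 'I_N) (i j : 'I_N.-1) : (lift h i < lift h j)%N = (i < j)%N.
Proof. by rewrite /= /bump; case: (leqP h i); case: (leqP h j); lia. Qed.

(** The new first pair (0, j + 1) opens with the least value, and [lift] is increasing, so only the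
    conditions on [t] remain. *)
Lemma pf_perm_lift N (j : 'I_N.+1) (t : 'S_N) :
  pf_perm (lift_perm 0 0 (lift_perm 0 j t)) = pf_perm t.
Proof.
have t1 i : lift_perm 0 0 (lift_perm 0 j t) (pfidx1 (lift ord0 i : 'I_(N.+2)./2))
    = lift 0 (lift j (t (pfidx1 i))) by rewrite pfidx1_lift !lift_perm_lift.
have t2 i : lift_perm 0 0 (lift_perm 0 j t) (pfidx2 (lift ord0 i : 'I_(N.+2)./2))
    = lift 0 (lift j (t (pfidx2 i))) by rewrite pfidx2_lift !lift_perm_lift.
congr (_ && _).
  apply/forallP/forallP => H i; first by have := H (lift ord0 i); rewrite t1 t2 !ltn_lift.
  case: (unliftP ord0 i) => [i'|] ->; first by rewrite t1 t2 !ltn_lift.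
  by rewrite pfidx1_0 pfidx2_0 lift_perm_lift !lift_perm_id.
apply/forallP/forallP => H i; apply/forallP => k.
  have /forallP/(_ (lift ord0 k)) := H (lift ord0 i).
  by rewrite !t1 !ltn_lift.
case: (unliftP ord0 i) => [i'|] ->; case: (unliftP ord0 k) => [k'|] ->.
- by have /forallP/(_ k') := H i'; rewrite !t1 !ltn_lift.
- by [].
- by rewrite t1 pfidx1_0 lift_perm_id.
- by [].
Qed.

(** An admissible permutation fixes 0 and amounts to the partner [lift 0 j] of 0 together with an
    admissible permutation of the rest; [lift_perm 0 j] accounts for the sign (-1)^j. *)
Lemma Pf_row0 (R : comNzRingType) N (A : 'M[R]_N.+2) : ~~ odd N ->
  Pf A = \sum_(j < N.+1) (-1) ^+ j * A 0 (lift 0 j) *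
           Pf (mxsub (fun k => lift 0 (lift j k)) (fun k => lift 0 (lift j k)) A).
Proof.
move=> evN; rewrite /Pf.
rewrite (eq_bigl (fun s : 'S_N.+2 => (s 0 == 0) && pf_perm s)); last first.
  by move=> s; case: (boolP (pf_perm s)) => [/pf_perm0->|_]; rewrite ?andbF.
rewrite big_perm_lift.
rewrite (partition_big (fun s : 'S_N.+1 => s 0) predT) //=; apply: eq_bigr => j _.
rewrite (eq_bigl (fun s : 'S_N.+1 => (s 0 == j) && pf_perm (lift_perm 0 0 s))); last first.
  by move=> s; rewrite andbC.
rewrite big_perm_lift big_distrr; apply: eq_big => [t|t _]; first exact: pf_perm_lift.
rewrite /= !odd_lift_perm /= signr_addb signr_odd big_ord_recl pfidx1_0 pfidx2_0.
rewrite lift_perm_lift !lift_perm_id -!mulrA; congr (_ * _).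
rewrite mulrCA; congr (_ * (_ * _)); apply: eq_bigr => i _.
by rewrite pfidx1_lift pfidx2_lift !lift_perm_lift mxE.
Qed.

(** The size is tied to [m] by an equation, so that matrices of size [n + l] are covered without
    casts. *)
Lemma Pf_pfs (R : comNzRingType) (T : eqType) (f : T -> T -> R) x0 m N (A : 'M_N) s :
  N = m.*2 -> size s = N -> uniq s ->
  (forall i j, A i j = f (nth x0 s i) (nth x0 s j)) -> Pf A = pfs f m s.
Proof.
move=> eN; subst N; elim: m s A => [|m IH] [|x s] A //= szs us Af.
- rewrite /Pf (eq_bigl predT) => [|t]; last by apply/andP; split; apply/forallP; case.
  rewrite (big_pred1 1%g) => [|t]; last first.
    by apply/esym/eqP/permP; case.
  by rewrite odd_perm1 big_ord0 mulr1.
case: szs us => szs /andP[xs us].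
rewrite (@Pf_row0 _ m.*2) ?odd_double // (big_nth x0) szs big_mkord.
apply: eq_bigr => j _; have lt_js : (j < size s)%N by rewrite szs.
rewrite index_uniq // Af; congr (_ * _).
apply: IH; first by rewrite size_rem ?mem_nth // szs.
  exact: rem_uniq.
by move=> i k; rewrite mxE Af !nth_rem.
Qed.

(** * Schur's Pfaffian *)

Section Identities.
Variable F : fieldType.
Implicit Types (s : seq F) (x y z t : F).

(** Having degree below [size s], [p] equals its Lagrange interpolant [L] at the nodes [s]. Each
    numerator in [L] is monic of degree [size s - 1], so the sum is the coefficient of [L] in that
    degree. *)
Lemma lagrange_lead_coef s (p : {poly F}) : uniq s -> (0 < size s)%N ->
  (size p <= size s)%N ->
  \sum_(y <- s) p.[y] / \prod_(z <- rem y s) (y - z) = p`_(size s).-1.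
Proof.
move=> us s_gt0 szp.
pose L : {poly F} := \sum_(y <- s)
  (p.[y] / \prod_(z <- rem y s) (y - z)) *: \prod_(z <- rem y s) ('X - z%:P).
have szP y : y \in s -> size (\prod_(z <- rem y s) ('X - z%:P)) = size s.
  by move=> ys; rewrite size_prod_XsubC size_rem // prednK.
have pL : p = L.
  apply/eqP; rewrite -subr_eq0; apply/eqP.
  apply: (@roots_geq_poly_eq0 _ _ s) => //; last first.
    rewrite (leq_trans (size_polyD _ _)) // geq_max szp size_polyN.
    apply: leq_trans (size_sum _ _ _) _; apply/bigmax_leqP_seq => y ys _.
    by rewrite (leq_trans (size_scale_leq _ _)) // szP.
  apply/allP => y ys; apply/rootP; rewrite hornerD hornerN; apply/eqP.
  rewrite subr_eq0; apply/eqP.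
  rewrite /L horner_sum (big_rem y) //= [X in _ + X]big_seq.
  rewrite [X in _ + X]big1 => [|z].
    rewrite addr0 hornerZ horner_prod.
    rewrite [X in _ * X](eq_bigr (fun z => y - z)) => [|z _]; last exact: hornerXsubC.
    rewrite divfK // prodf_seq_neq0; apply/allP => z.
    by rewrite mem_rem_uniq // inE subr_eq0 eq_sym => /andP[].
  rewrite mem_rem_uniq // inE => /andP[nzy zs].
  rewrite hornerZ horner_prod [X in _ * X](big_rem y) ?mem_rem_uniq ?inE 1?eq_sym ?nzy //=.
  by rewrite hornerXsubC subrr mul0r mulr0.
rewrite [in RHS]pL /L coef_sum !big_seq; apply: eq_bigr => y ys; rewrite coefZ.
set q := \prod_(z <- _) ('X - z%:P).
have /monicP : q \is monic by apply: monic_prod_XsubC.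
by rewrite /lead_coef (szP y ys : size q = _) => ->; rewrite mulr1.
Qed.

Definition sum_neq0 s := {in s &, forall y z, y != z -> y + z != 0}.

Lemma sum_neq0_sub s1 s2 : {subset s1 <= s2} -> sum_neq0 s2 -> sum_neq0 s1.
Proof. by move=> sub H y z /sub ys /sub zs; apply: H. Qed.

(** With P the right-hand side, the nodes [- t], 0 and [y] contribute -2 P, -(-1)^b and twice the
    summand at [y]; the total is the leading coefficient -1. The term [b%:R] stands for an appended
    variable 0. *)
Lemma reflection_sum (b : bool) t s : (2%:R != 0 :> F) -> uniq (t :: s) ->
  sum_neq0 (t :: s) -> 0 \notin t :: s -> odd (size s) = ~~ b ->
  \sum_(y <- s) (t - y) / (t + y) * \prod_(z <- rem y s) ((y + z) / (y - z)) + b%:R =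
  \prod_(y <- s) ((t - y) / (t + y)).
Proof.
move=> two_neq0 /= /andP[ts us] sum_ts; rewrite inE negb_or => /andP[t0 s0] odd_s.
rewrite eq_sym in t0.
have ty y : y \in s -> t + y != 0.
  move=> ys; apply: sum_ts; rewrite ?inE ?eqxx ?ys ?orbT //.
  by apply: contraNneq ts => ->.
have y0 y : y \in s -> y != 0 by move=> ys; apply: contraNneq s0 => <-.
have Nts : - t \notin s.
  by apply/negP => /ty; rewrite subrr eqxx.
(* This is (t - X) prod (X + z), written as minus a product of monic factors so that its leading
   coefficient can be read off. *)
pose p := - \prod_(z <- t :: map -%R s) ('X - z%:P).
have p_val y : p.[y] = (t - y) * \prod_(z <- s) (y + z).
  rewrite /p hornerN horner_prod big_cons big_map hornerXsubC -mulNr opprB.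
  by congr (_ * _); apply: eq_bigr => z _; rewrite hornerXsubC opprK.
have sz_p : size p = (size s).+2 by rewrite /p size_polyN size_prod_XsubC /= size_map.
have p_lead : p`_(size s).+1 = -1.
  rewrite /p coefN; congr (- _).
  have /monicP : \prod_(z <- t :: map -%R s) ('X - z%:P) \is monic.
    exact: monic_prod_XsubC.
  by rewrite /lead_coef size_prod_XsubC /= size_map.
pose nodes := [:: - t, 0 & s].
have u_nodes : uniq nodes by rewrite /= !inE negb_or oppr_eq0 t0 Nts s0.
have := lagrange_lead_coef u_nodes isT (eq_leq sz_p).
have rem1 : rem (- t) nodes = 0 :: s by rewrite /= eqxx.
have rem2 : rem 0 nodes = - t :: s by rewrite /= oppr_eq0 (negPf t0) eqxx.
have rem3 y : y \in s -> rem y nodes = [:: - t, 0 & rem y s].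
  move=> ys; rewrite /= eq_sym; case: eqVneq => [e|_]; first by rewrite -e ys in Nts.
  by rewrite eq_sym (negPf (y0 _ ys)).
rewrite p_lead {1}/nodes !big_cons rem1 rem2 !big_cons.
rewrite !p_val subr0 !opprK add0r.
have P0 : \prod_(z <- s) (0 + z) != 0.
  by rewrite prodf_seq_neq0; apply/allP => y /y0; rewrite add0r.
have -> : \prod_(z <- s) (0 - z) = (-1) ^+ size s * \prod_(z <- s) (0 + z).
  rewrite (eq_bigr (fun z => -1 * (0 + z))) => [|z _]; last by rewrite !add0r mulN1r.
  by rewrite big_split big_const_seq count_predT iter_mulr_1.
have -> : (t + t) * \prod_(z <- s) (- t + z) /
    (- t * \prod_(z <- s) (- t - z)) =
    - ((\prod_(y <- s) ((t - y) / (t + y))) *+ 2).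
  have <- : \prod_(z <- s) ((- t + z) / (- t - z)) = \prod_(y <- s) ((t - y) / (t + y)).
    apply: eq_bigr => z _; rewrite -[t - z]opprK -[t + z]opprK invrN mulrNN.
    by rewrite opprB opprD addrC.
  have Q0 : \prod_(z <- s) (- t - z) != 0.
    rewrite prodf_seq_neq0; apply/allP => y ys /=.
    by rewrite -opprD oppr_eq0 ty.
  by rewrite prodf_div; field; rewrite Q0 oppr_eq0.
have -> : \sum_(y <- s) p.[y] / \prod_(z <- rem y nodes) (y - z) =
  (\sum_(y <- s) (t - y) / (t + y) * \prod_(z <- rem y s) ((y + z) / (y - z))) *+ 2.
  rewrite -sumrMnl; apply: eq_big_seq => y ys.
  rewrite rem3 // !big_cons p_val (big_rem y ys) /= prodf_div.
  have Q0 : \prod_(z <- rem y s) (y - z) != 0.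
    rewrite prodf_seq_neq0; apply/allP => z.
    by rewrite mem_rem_uniq // inE subr_eq0 eq_sym => /andP[].
  by field; rewrite Q0 ty ?y0.
set S := \sum_(y <- s) _; set P := \prod_(y <- s) _.
set Q := \prod_(z <- s) _ in P0 *.
(* At the node 0 only (-1)^(size s) is left, which the parity hypothesis turns into -(-1)^b. *)
have -> : (t - 0) * Q / (t * ((-1) ^+ size s * Q)) = - (-1) ^+ b.
  rewrite -signr_odd odd_s subr0.
  have tQ : t * Q != 0 by rewrite mulf_neq0.
  by case: b {odd_s}; rewrite /= ?mul1r ?mulN1r ?mulrN ?invrN ?mulrN divff ?opprK.
move=> e; apply: (mulfI two_neq0).
have {}e : 2%:R * S = -1 - (P *- 2 + - (-1) ^+ b).
  have -> : 2%:R * S = P *- 2 + (- (-1) ^+ b + S *+ 2) - (P *- 2 + - (-1) ^+ b) by ring.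
  by rewrite e.
by rewrite mulrDr e; case: b {odd_s e} => /=; rewrite ?expr0 ?expr1; ring.
Qed.

End Identities.

(** * The product of the (x - y) / (x + y) and Schur's evaluation *)

Section SchurPfaffian.
Variable F : fieldType.
Implicit Types (s : seq F) (x y z t : F).

Fixpoint schur_prod s : F :=
  if s is x :: s' then \prod_(y <- s') ((x - y) / (x + y)) * schur_prod s' else 1.

Lemma schur_prod_neq0 s : uniq s -> sum_neq0 s -> schur_prod s != 0.
Proof.
elim: s => [|x s IH] /= us sum_s; first exact: oner_neq0.
case/andP: us => xs us; rewrite mulf_neq0 ?IH //; last first.
  by apply: sum_neq0_sub sum_s => y ys; rewrite inE ys orbT.
rewrite prodf_seq_neq0; apply/allP => y ys /=.
have xy : x != y by apply: contraNneq xs => ->.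
by rewrite mulf_neq0 ?invr_eq0 ?subr_eq0 // sum_s // !inE ?eqxx // ys orbT.
Qed.

(** Moving [y] to the front changes the sign of one factor for each of the [index y s] entries
    before it. *)
Lemma schur_prod_rem s y : y \in s ->
  schur_prod s = (-1) ^+ index y s *
    \prod_(z <- rem y s) ((y - z) / (y + z)) * schur_prod (rem y s).
Proof.
elim: s => //= x s IH; rewrite inE eq_sym.
case: eqVneq => [->|nxy] /= ys; first by rewrite mul1r.
rewrite IH // (big_rem y ys) big_cons /= exprS.
have -> : (x - y) / (x + y) = - ((y - x) / (y + x)).
  by rewrite -mulNr opprB [y + x]addrC.
by ring.
Qed.

Lemma schur_prod_mul_rem s y : uniq s -> sum_neq0 s -> y \in s ->
  schur_prod s * \prod_(z <- rem y s) ((y + z) / (y - z)) =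
  (-1) ^+ index y s * schur_prod (rem y s).
Proof.
move=> us sum_s ys; rewrite (schur_prod_rem ys).
have e : \prod_(z <- rem y s) ((y - z) / (y + z)) *
         \prod_(z <- rem y s) ((y + z) / (y - z)) = 1.
  rewrite -big_split big_seq big1 //= => z.
  rewrite mem_rem_uniq // inE => /andP[nzy zs].
  have yz : y - z != 0 by rewrite subr_eq0 eq_sym.
  by field; rewrite yz sum_s // eq_sym.
by rewrite mulrAC -[_ * _ * \prod_(z <- _) _]mulrA e mulr1.
Qed.

Variable a : nat -> F.

(* The entries of A_lambda: [inl x] stands for the variable [x], and [inr k]
   for the column of the part [k] of lambda. *)
Definition bordered (u v : F + nat) : F :=
  match u, v with
  | inl x, inl y => (x - y) / (x + y)
  | inl x, inr k => mpow a x k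
  | inr k, inl y => - mpow a y k
  | inr _, inr _ => 0
  end.


Hypothesis two_neq0 : 2%:R != 0 :> F.

Lemma sum_neq0_rem s y : sum_neq0 s -> sum_neq0 (rem y s).
Proof. by apply: sum_neq0_sub => z; apply: mem_rem. Qed.

(* The list [nseq b 0] holds the appended variable 0, if any. *)
Lemma schur_pfaffian (b : bool) m s : uniq s -> sum_neq0 s -> 0 \notin s ->
  (size s + b)%N = m.*2 ->
  pfs bordered m (map inl (s ++ nseq b 0)) = schur_prod s.
Proof.
elim: m b s => [|m IH] b [|t s] // us sum_s s0; first by case: b.
rewrite /= addSn => [[szs]].
have /andP[ts us'] := us; have sub : {subset s <= t :: s}.
  by move=> y ys; rewrite inE ys orbT.
have s0' : 0 \notin s by apply: contra s0 => /sub.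
have sum_s' : sum_neq0 s by apply: sum_neq0_sub sum_s.
have odd_s : odd (size s) = ~~ b by case: b szs; lia.
have t0 : t != 0 by apply: contraNneq s0 => ->; rewrite inE eqxx.
(* [reflection_sum] replaces the factors that involve [t]: its summands match the columns of [s] in
   the first-row expansion, and [b%:R] the column of the appended 0. *)
rewrite -(reflection_sum two_neq0 us sum_s s0 odd_s) mulrDl mulr_suml big_map big_cat.
congr (_ + _).
  apply: eq_big_seq => y ys.
  rewrite (index_map inl_inj) (rem_map _ _ inl_inj) index_cat ys rem_cat_in //.
  rewrite IH ?rem_uniq //; last by rewrite size_rem //; case: (s) ys szs => //= *; lia.
  - rewrite -[RHS]mulrA [_ * schur_prod s]mulrC schur_prod_mul_rem //=; ring.
  - exact: sum_neq0_rem.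
  - by apply: contra s0'; apply: mem_rem.
case: b szs odd_s => szs odd_s; last by rewrite big_nil mul0r.
(* The appended 0 has the entry (t - 0) / (t + 0) = 1 at an even index, and its removal leaves [s]
   with nothing appended. *)
rewrite big_seq1 (index_map inl_inj) (rem_map _ _ inl_inj).
rewrite index_cat (negPf s0') /= eqxx addn0 -signr_odd odd_s /=.
rewrite cats1 rem_rcons_last // subr0 addr0 divff // !mul1r.
rewrite -[s in map _ s]cats0 (IH false) // addn0.
by case: szs; lia.
Qed.

End SchurPfaffian.

(** * The recursion on the length of lambda *)

Section Main.
Variables (F : fieldType) (a : nat -> F).
Implicit Types (s : seq F) (x y z t : F).

Fixpoint schurP_seq (lam : seq nat) s : F :=
  if lam is k :: lam' then
    \sum_(y <- s) mpow a y k * \prod_(z <- rem y s) ((y + z) / (y - z)) *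
                  schurP_seq lam' (rem y s)
  else 1.

Lemma mpow0 k : a 1%N = 0 -> (0 < k)%N -> mpow a 0 k = 0.
Proof. by case: k => // k a1 _; rewrite /mpow big_ltn // a1 subrr mul0r. Qed.

Hypothesis two_neq0 : 2%:R != 0 :> F.
Hypothesis a1 : a 1%N = 0.

(** [rev] puts the column of the head of [lam] last, ready for [pfs_rcons]; deleting it along with a
    variable of [s] leaves a list of the same form with the same [b]. *)
Lemma pfs_bordered (b : bool) m lam s :
  uniq lam -> all (fun k => 0 < k)%N lam ->
  uniq s -> sum_neq0 s -> 0 \notin s ->
  (size s + b + size lam)%N = m.*2 ->
  pfs (bordered a) m (map inl (s ++ nseq b 0) ++ map inr (rev lam)) =
  schur_prod s * schurP_seq lam s.
Proof.
elim: lam m s => [|k lam IH] m s.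
  by rewrite addn0 cats0 mulr1 => _ _; apply: schur_pfaffian.
move=> /= /andP[k_lam u_lam] /andP[k_gt0 lam_gt0] us sum_s s0 szs.
case: m szs => [|m szs]; first by lia.
set S := map inl (s ++ nseq b 0).
have uS : uniq S.
  rewrite map_inj_uniq; last exact: inl_inj.
  by rewrite cat_uniq us /=; case: (b); rewrite //= orbF andbT.
rewrite rev_cons map_rcons -rcons_cat pfs_rcons; last 2 first.
- rewrite rcons_uniq mem_cat negb_or cat_uniq uS (map_inj_uniq (@inr_inj _ _)) rev_uniq u_lam.
  rewrite (mem_map (@inr_inj _ _)) mem_rev k_lam !andbT /=; apply/andP; split.
    by apply/mapP => -[].
  by apply/hasPn => _ /mapP[j _ ->]; apply/mapP => -[].
- by rewrite size_cat !size_map size_cat size_nseq size_rev; lia.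
(* The rows of the other parts drop out because the lower right block is 0. *)
rewrite big_cat /= [X in _ + X]big_map [X in _ + X]big1 ?addr0; last first.
  by move=> j _; rewrite mulr0 mul0r.
rewrite big_map big_cat /= [X in _ + X]big1_seq ?addr0; last first.
  by move=> y /=; rewrite mem_nseq => /andP[_ /eqP->]; rewrite mpow0 // mulr0 mul0r.
rewrite mulr_sumr; apply: eq_big_seq => y ys.
have yS : inl y \in S by rewrite (mem_map (@inl_inj _ _)) mem_cat ys.
rewrite index_cat yS rem_cat_in // /S (index_map (@inl_inj _ _)) (rem_map _ _ (@inl_inj _ _)).
rewrite index_cat ys rem_cat_in // IH ?rem_uniq //.
- by rewrite [RHS]mulrA [schur_prod s * _]mulrCA schur_prod_mul_rem //=; ring.
- exact: sum_neq0_rem.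
- by apply: contra s0; apply: mem_rem.
- by rewrite size_rem //; case: (s) ys szs => //= *; lia.
Qed.

End Main.

(** * The recursion for Schur P-functions *)

Lemma big_ord_recl_false (R : Type) (idx : R) (op : Monoid.com_law idx) n
    (P : pred 'I_n.+1) (G : 'I_n.+1 -> R) : ~~ P ord0 ->
  \big[op/idx]_(i < n.+1 | P i) G i =
  \big[op/idx]_(i < n | P (lift ord0 i)) G (lift ord0 i).
Proof.
by move=> nP0; rewrite big_mkcond big_ord_recl (negPf nP0) Monoid.mul1m -big_mkcond.
Qed.

(** Fixing [w 0 = i] selects the variable attached to the first part. As n - l is constant along the
    recursion, the factor 1/(n-l)! reaches the base case, where it cancels (n-l)! summands equal to
    1; characteristic 0 makes it invertible. *)
Lemma schurP_schurP_seq (F : fieldType) (a : nat -> F) l (lam : l.-tuple nat) n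
    (x : 'rV[F]_n) (s : seq F) :
  [pchar F] =i pred0 -> (l <= n)%N -> uniq s -> size s = n ->
  (forall i, x 0 i = nth 0 s i) -> schurP a lam x = schurP_seq a lam s.
Proof.
move=> char0; elim: l lam n x s => [|l IH] lam n x s.
  move=> _ _ _ _; rewrite tuple0 /schurP subn0 (eq_bigr (fun=> 1)) => [|w _]; last first.
    by rewrite !big_pred0 ?mulr1.
  rewrite sumr_const card_Sn mulVf //.
  by move/pcharf0P: char0 => ->; rewrite -lt0n fact_gt0.
case: n x => // n x le_ln us szs xs; rewrite ltnS in le_ln.
case/tupleP: lam => k lam; rewrite /schurP subSS /= (big_nth 0) szs big_mkord.
rewrite (partition_big (fun w : 'S_n.+1 => w 0) predT) //= big_distrr.
apply: eq_bigr => i _ /=.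
rewrite (eq_bigl (fun w : 'S_n.+1 => (w 0 == i) && true)); last by move=> w; rewrite andbT.
rewrite big_perm_lift.
have lt_is : (i < size s)%N by rewrite szs.
have sz_rem : size (rem (nth 0 s i) s) = n by rewrite size_rem ?mem_nth // szs.
rewrite -(IH lam _ (\row_j x 0 (lift i j))) ?rem_uniq //; last first.
  by move=> j; rewrite mxE xs nth_rem.
rewrite /schurP mulrCA; congr (_ * _); rewrite big_distrr /=; apply: eq_bigr => t _.
rewrite (bigD1_ord ord0) //= [X in _ * X = _](bigD1_ord ord0) //=.
rewrite !lift_perm_id xs.
(* The factors pairing the first position with the later ones run over all the other variables, so
   [t] only permutes them. *)
have -> : \prod_(j < n.+1 | (0 < j)%N)
    ((nth 0 s i + x 0 (lift_perm 0 i t j)) / (nth 0 s i - x 0 (lift_perm 0 i t j))) =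
    \prod_(z <- rem (nth 0 s i) s) ((nth 0 s i + z) / (nth 0 s i - z)).
  rewrite big_ord_recl_false // (big_nth 0) sz_rem big_mkord.
  rewrite [RHS](reindex_inj (@perm_inj _ t)); apply: eq_bigr => j _.
  by rewrite lift_perm_lift xs nth_rem.
have -> : \prod_(j < n | (bump 0 j < l.+1)%N)
    mpow a (x 0 (lift_perm 0 i t (lift ord0 j))) (nth 0%N (k :: lam) (bump 0 j)) =
    \prod_(j < n | (j < l)%N) mpow a ((\row_j x 0 (lift i j)) 0 (t j)) (nth 0%N lam j).
  by apply: eq_bigr => j _; rewrite lift_perm_lift mxE.
have -> : \prod_(j < n | (bump 0 j < l.+1)%N) \prod_(j' < n.+1 | (bump 0 j < j')%N)
    ((x 0 (lift_perm 0 i t (lift ord0 j)) + x 0 (lift_perm 0 i t j')) /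
     (x 0 (lift_perm 0 i t (lift ord0 j)) - x 0 (lift_perm 0 i t j'))) =
    \prod_(j < n | (j < l)%N) \prod_(j' < n | (j < j')%N)
    (((\row_j x 0 (lift i j)) 0 (t j) + (\row_j x 0 (lift i j)) 0 (t j')) /
     ((\row_j x 0 (lift i j)) 0 (t j) - (\row_j x 0 (lift i j)) 0 (t j'))).
  apply: eq_bigr => j _; rewrite big_ord_recl_false //.
  by apply: eq_bigr => j' _; rewrite !lift_perm_lift !mxE.
by rewrite !mulrA; congr (_ * _); rewrite -!mulrA; congr (_ * _); rewrite mulrC.
Qed.

(** On the diagonal the numerator is 0, and so is the quotient, even for the variable 0, where the
    denominator vanishes and 0 / 0 is 0. *)
Lemma A0E (F : fieldType) n (x : 'rV[F]_n) i j :
  A0 x i j = (x 0 i - x 0 j) / (x 0 i + x 0 j).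
Proof. by rewrite mxE; case: eqVneq => // ->; rewrite subrr mul0r. Qed.

(** * From matrices to sequences of variables and parts *)

Section PfaffianMatrices.
Variables (F : fieldType) (a : nat -> F).

Lemma Pf_A0 n (x : 'rV[F]_n) s m :
  n = m.*2 -> uniq s -> size s = n -> (forall i, x 0 i = nth 0 s i) ->
  Pf (A0 x) = pfs (bordered a) m (map inl s).
Proof.
move=> en us szs xs; apply: (@Pf_pfs _ _ _ (inl 0)) => //.
- by rewrite size_map.
- by rewrite (map_inj_uniq (@inl_inj _ _)).
by move=> i j; rewrite A0E !(nth_map 0) ?szs //= !xs.
Qed.

Lemma Pf_Alam n (x : 'rV[F]_n) l (lam : l.-tuple nat) s m :
  (n + l)%N = m.*2 -> uniq lam -> uniq s -> size s = n ->
  (forall i, x 0 i = nth 0 s i) ->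
  Pf (Alam a lam x) = pfs (bordered a) m (map inl s ++ map inr (rev lam)).
Proof.
move=> enl u_lam us szs xs; apply: (@Pf_pfs _ _ _ (inl 0)) => //.
- by rewrite size_cat !size_map size_rev szs size_tuple.
- rewrite cat_uniq (map_inj_uniq (@inl_inj _ _)) us (map_inj_uniq (@inr_inj _ _)).
  rewrite rev_uniq u_lam andbT /=.
  by apply/hasPn => _ /mapP[j _ ->]; apply/mapP => -[].
have nth_l (i : 'I_n) : nth (inl 0) (map inl s ++ map inr (rev lam)) (lshift l i) =
    inl (x 0 i).
  by rewrite nth_cat size_map szs /= ltn_ord (nth_map 0) ?szs // xs.
(* The columns of [Blam] carry the parts from last to first, hence [rev lam]. *)
have nth_r (i : 'I_l) : nth (inl 0) (map inl s ++ map inr (rev lam)) (rshift n i) =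
    inr (tnth lam (rev_ord i)).
  rewrite nth_cat size_map szs /= ltnNge leq_addr /= addKn.
  rewrite (nth_map 0%N) ?size_rev ?size_tuple // nth_rev ?size_tuple //.
  by rewrite (tnth_nth 0%N).
move=> i j; rewrite /Alam.
case: (split_ordP i) => i' ->; case: (split_ordP j) => j' ->; rewrite ?nth_l ?nth_r /=.
- by rewrite block_mxEul A0E.
- by rewrite block_mxEur mxE.
- by rewrite block_mxEdl !mxE.
- by rewrite block_mxEdr mxE.
Qed.

(** * The identity at a point with distinct nonzero coordinates, no two of them adding up to 0 *)

Variables (n : nat) (x : 'rV[F]_n).
Hypothesis char0 : [pchar F] =i pred0.
Hypothesis x_inj : injective (x 0).
Hypothesis x_neq0 : forall i, x 0 i != 0.
Hypothesis x_sum : forall i j, i != j -> x 0 i + x 0 j != 0.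

Let s := [seq x 0 i | i <- enum 'I_n].

Let szs : size s = n. Proof. by rewrite size_map size_enum_ord. Qed.
Let us : uniq s. Proof. by rewrite map_inj_uniq ?enum_uniq. Qed.
Let xs i : x 0 i = nth 0 s i.
Proof. by rewrite (nth_map i) ?size_enum_ord // nth_ord_enum. Qed.
Let s0 : 0 \notin s.
Proof. by apply/mapP => -[i _ e]; have := x_neq0 i; rewrite -e eqxx. Qed.
Let sum_s : sum_neq0 s.
Proof.
by move=> _ _ /mapP[i _ ->] /mapP[j _ ->] nij; apply: x_sum; apply: contraNneq nij => ->.
Qed.
Let us_rcons : uniq (s ++ [:: 0]).
Proof. by rewrite cats1 rcons_uniq s0. Qed.
Let szs_rcons : size (s ++ [:: 0]) = (n + 1)%N.
Proof. by rewrite size_cat szs. Qed.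
Let xs_rcons i : append0 x 0 i = nth 0 (s ++ [:: 0]) i.
Proof.
rewrite /append0; case: (split_ordP i) => j ->; rewrite ?row_mxEl ?row_mxEr nth_cat szs.
  by rewrite /= ltn_ord xs.
by rewrite (ord1 j) mxE /= addn0 ltnn subnn.
Qed.
Let two_neq0 : 2%:R != 0 :> F.
Proof. by move/pcharf0P: char0 => ->. Qed.

Lemma Pf0_schur_prod : Pf0 x = schur_prod s.
Proof.
rewrite /Pf0; case: ifP => [n_odd|n_even].
  rewrite (@Pf_A0 _ _ (s ++ [:: 0]) (n.+1)./2) //; last by lia.
  by apply: (@schur_pfaffian _ _ _ true) => //; rewrite szs; lia.
rewrite (@Pf_A0 _ _ s n./2) //; last by lia.
by rewrite -[s in LHS]cats0; apply: (@schur_pfaffian _ _ _ false) => //; rewrite szs; lia.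
Qed.

Lemma Pf0_neq0 : Pf0 x != 0.
Proof. by rewrite Pf0_schur_prod schur_prod_neq0. Qed.

Lemma Pflam_schurP l (lam : l.-tuple nat) :
  a 1%N = 0 -> strict_partition lam -> (l <= n)%N ->
  Pflam a lam x = Pf0 x * schurP a lam x.
Proof.
move=> a1 /andP[lam_sorted lam_gt0] le_ln.
(* Strict decrease keeps the labels [inr k] of the columns distinct. *)
have u_lam : uniq lam.
  by apply: sorted_uniq lam_sorted; [exact: (rev_trans ltn_trans) | move=> k; rewrite /= ltnn].
rewrite Pf0_schur_prod (@schurP_schurP_seq _ _ _ _ _ _ s) // /Pflam.
case: ifP => [nl_odd|nl_even].
  rewrite (@Pf_Alam _ _ _ _ (s ++ [:: 0]) (n + l).+1./2) //; last by lia.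
  by apply: (@pfs_bordered _ _ _ _ true) => //; rewrite szs size_tuple; lia.
rewrite (@Pf_Alam _ _ _ _ s (n + l)./2) //; last by lia.
rewrite -[s in LHS]cats0.
by apply: (@pfs_bordered _ _ _ _ false) => //; rewrite szs size_tuple; lia.
Qed.

End PfaffianMatrices.

(** * The generic point *)

Section RatX.
Variables (C : numFieldType) (n : nat).

(** Nonvanishing of a rational function is certified below by evaluating a polynomial at one
    point. *)
Lemma tofrac_meval_neq0 (p : {mpoly C[n]}) (v : 'I_n -> C) :
  p.@[v] != 0 -> FracField.tofrac p != 0.
Proof. by apply: contraNneq => /eqP; rewrite tofrac_eq0 => /eqP->; rewrite meval0. Qed.

Lemma ratfun_pchar0 : [pchar (ratfun C n)] =i pred0.
Proof.
apply/pcharf0P => k; case: (posnP k) => [->|k_gt0]; first by rewrite !eqxx.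
rewrite -(rmorph_nat (@FracField.tofrac _)); apply/negbTE.
apply: (@tofrac_meval_neq0 _ (fun=> 0)).
by rewrite rmorph_nat Num.Theory.pnatr_eq0 -lt0n.
Qed.

(** At the point with all coordinates 1 the value is 2. The case i = j yields [ratX_neq0]. *)
Lemma ratX_sum_neq0 i j : ratX C n 0 i + ratX C n 0 j != 0.
Proof.
rewrite !mxE -tofracD; apply: (@tofrac_meval_neq0 _ (fun=> 1)).
by rewrite mevalD !mevalXU -[_ + _]/(2%:R) Num.Theory.pnatr_eq0.
Qed.

Lemma ratX_neq0 i : ratX C n 0 i != 0.
Proof. by apply: contraNneq (ratX_sum_neq0 i i) => ->; rewrite addr0. Qed.

Lemma ratX_inj : injective (ratX C n 0).
Proof.
move=> i j e; apply/eqP/negPn/negP => nij.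
have : ratX C n 0 i - ratX C n 0 j != 0.
  rewrite !mxE -tofracB; apply: (@tofrac_meval_neq0 _ (fun k => (k == i)%:R)).
  by rewrite mevalB !mevalXU eqxx [j == i]eq_sym (negPf nij) subr0 oner_neq0.
by rewrite e subrr eqxx.
Qed.

End RatX.

(** Division by 0 returns 0 in a [fieldType], so the nonvanishing of the denominator is stated along
    with the quotient. *)
Theorem theorem3p2 (R : realType) (a : nat -> R[i]) (l n : nat)
    (lam : l.-tuple nat) :
  a 1%N = 0 -> strict_partition lam -> (l <= n)%N ->
  let x := ratX (R[i]) n in
  let b := fun k => ratC n (a k) in
  Pf0 x != 0 /\ schurP b lam x = Pflam b lam x / Pf0 x.
Proof.
move=> a1 lam_strict le_ln x b.
have char0 := @ratfun_pchar0 R[i] n.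
have x_sum i j : i != j -> x 0 i + x 0 j != 0 by move=> _; apply: ratX_sum_neq0.
have b1 : b 1%N = 0 by rewrite /b /ratC a1 mpolyC0 tofrac0.
have Pf0_neq0 := Pf0_neq0 b char0 (@ratX_inj _ _) (@ratX_neq0 _ _) x_sum.
split=> //.
rewrite (Pflam_schurP char0 (@ratX_inj _ _) (@ratX_neq0 _ _) x_sum) //.
by rewrite mulrC mulKf.
Qed.
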